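(* If $m$ is a non-negative integer, then \[ \sum_{n=1}^\infty\frac{2^{2n}}{n(n+1)(n+2)(n+3)\binom{2(n+m)}{n+m}\binom{n+m}{m}}=\frac{1}{12\binom{2m}{m}}\left(m-\frac12\right)\left(m+\frac12\right)\left(m+\frac32\right)\left(4O_m^{(2)}-3\zeta(2)\right)+\frac{1}{4\binom{2m}{m}}\left(\frac{m^2}{3}+\frac m2-\frac19\right). \] In particular, \[ \sum_{n=1}^\infty\frac{2^{2n}}{n(n+1)(n+2)(n+3)\binom{2n}{n}}=\frac{\pi^2}{64}-\frac1{36},\qquad \sum_{n=1}^\infty\frac{2^{2n}}{n(n+1)^2(n+2)(n+3)\binom{2(n+1)}{n+1}}=\frac{29}{72}-\frac{5\pi^2}{128}, \] \[ \sum_{n=1}^\infty\frac{2^{2n+1}}{n(n+1)^2(n+2)^2(n+3)\binom{2(n+2)}{n+2}}=\frac{65}{72}-\frac{35\pi^2}{384}. \]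
   Context: $\zeta$ is the Riemann zeta function. For nonnegative integer $m$, $O_m^{(2)}=\sum_{j=1}^m(2j-1)^{-2}$ (empty sum $=0$). *)

(* Defs.v *)
From Stdlib Require Import Reals.
From Coquelicot Require Import Coquelicot.
Open Scope R_scope.

(* The Dirichlet series; this is the Riemann zeta function for real s > 1. *)
Definition zeta (s : R) : R := Series (fun k => / Rpower (INR (S k)) s).

(* [sum_n_m a 1 0] is the empty sum. *)
Definition odd_harmonic (r m : nat) : R :=
  sum_n_m (fun j => / (2 * INR j - 1) ^ r) 1 m.

(* Coquelicot's [C] (complex numbers) shadows the binomial coefficient. *)
Definition binom (n k : nat) : R := Binomial.C n k.

(* Main.v *)
(** Multiplied by [binom (2m) m] and with [a = m + 1/2], the [n]-th term becomes
    [(n-1)! / (a (a+1) ... (a+n-1)) / ((n+1)(n+2)(n+3))].  Gosper summation in [n] gives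
    [(a-1) U (a+1) - (a+2) U a = - 1 / (6a)] for the sum [U a], so the difference between [U a]
    and the claimed value, divided by [(a-1) a (a+1)], does not depend on [m].  It tends to [0]
    because [U] is bounded and the sum of the reciprocal odd squares is [3/4 zeta(2)].  The
    special cases also need [zeta(2) = pi^2/6], obtained by Daners' method: with [I_n] and [J_n]
    the integrals over [[0, pi/2]] of [cos^(2n)] and [x^2 cos^(2n)], integration by parts gives
    [1/n^2 = 2 (J_(n-1)/I_(n-1) - J_n/I_n)], and [J_n/I_n] tends to [0]. *)
Require Import Defs.
From Stdlib Require Import Reals Lra Lia.
From Coquelicot Require Import Coquelicot.
Open Scope R_scope.

(* Stated over [R] rather than a module carrier so that [field] applies to the side goals. *)
Lemma is_series_congr (a b : nat -> R) (l l' : R) :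
  is_series a l -> (forall n, a n = b n) -> l = l' -> is_series b l'.
Proof. intros Ha E <-; exact (is_series_ext a b l E Ha). Qed.

(** * Moments of even cosine powers on [[0, PI / 2]] *)

(** The cases [p = 0] and [p = 2] are the integrals [I_n] and [J_n] of Daners' method. *)
Definition cos_moment (p n : nat) : R :=
  RInt (fun x => x ^ p * cos x ^ (2 * n)) 0 (PI / 2).

Lemma is_RInt_cos_moment (p n : nat) :
  is_RInt (fun x => x ^ p * cos x ^ (2 * n)) 0 (PI / 2) (cos_moment p n).
Proof.
  apply (RInt_correct (V := R_CompleteNormedModule)), ex_RInt_continuous.
  intros x _; apply continuity_pt_filterlim, derivable_continuous_pt.
  apply ex_derive_Reals_0; auto_derive; trivial.
Qed.

(** Source of the Wallis recursion: for every [k] this antiderivative vanishes at both [0] and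
    [PI / 2]. *)
Lemma is_derive_sin_cos_pow (k : nat) (x : R) :
  is_derive (fun t => sin t * cos t ^ S k) x
    ((INR k + 2) * cos x ^ S (S k) - (INR k + 1) * cos x ^ k).
Proof.
  auto_derive; trivial.
  change (Init.Nat.pred (S k)) with k.
  change (match k with O => 1 | S _ => INR k + 1 end) with (INR (S k)).
  rewrite <- !tech_pow_Rmult, ?S_INR.
  assert (E : cos x * cos x = 1 - sin x * sin x)
    by (generalize (sin2_cos2 x); unfold Rsqr; lra).
  ring [E].
Qed.

(** Two integrations by parts packed into one antiderivative: the terms in [t * sin t * cos t ^ S k]
    from the two summands cancel. It too vanishes at both ends. *)
Lemma is_derive_sqr_sin_cos_pow (k : nat) (x : R) :
  is_derive (fun t => t * cos t ^ S (S k) + (INR k / 2 + 1) * (t ^ 2 * (sin t * cos t ^ S k))) x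
    (cos x ^ S (S k) + (INR k / 2 + 1)
       * (x ^ 2 * ((INR k + 2) * cos x ^ S (S k) - (INR k + 1) * cos x ^ k))).
Proof.
  auto_derive; trivial.
  change (Init.Nat.pred (S (S k))) with (S k); change (Init.Nat.pred (S k)) with k.
  change (match k with O => 1 | S _ => INR k + 1 end) with (INR (S k)).
  rewrite <- !tech_pow_Rmult, ?S_INR.
  assert (E : cos x * cos x = 1 - sin x * sin x)
    by (generalize (sin2_cos2 x); unfold Rsqr; lra).
  field [E].
Qed.

Lemma is_RInt_cos_moment_0 (n : nat) :
  is_RInt (fun x => (2 * INR n + 2) * cos x ^ S (S (2 * n)) - (2 * INR n + 1) * cos x ^ (2 * n))
    0 (PI / 2)
    ((2 * INR n + 2) * cos_moment 0 (S n) - (2 * INR n + 1) * cos_moment 0 n).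
Proof.
  refine (is_RInt_ext _ _ _ _ _ _ (is_RInt_minus _ _ _ _ _ _
     (is_RInt_scal _ _ _ (2 * INR n + 2) _ (is_RInt_cos_moment 0 (S n)))
     (is_RInt_scal _ _ _ (2 * INR n + 1) _ (is_RInt_cos_moment 0 n)))).
  intros x _; replace (2 * S n)%nat with (S (S (2 * n))) by lia.
  unfold minus, plus, opp, scal, mult; simpl; unfold mult; simpl; ring.
Qed.

Lemma is_RInt_cos_moment_2 (n : nat) :
  is_RInt (fun x => cos x ^ S (S (2 * n)) + (INR n + 1) * (x ^ 2 *
      ((2 * INR n + 2) * cos x ^ S (S (2 * n)) - (2 * INR n + 1) * cos x ^ (2 * n))))
    0 (PI / 2)
    (cos_moment 0 (S n) + (INR n + 1) *
      ((2 * INR n + 2) * cos_moment 2 (S n) - (2 * INR n + 1) * cos_moment 2 n)).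
Proof.
  refine (is_RInt_ext _ _ _ _ _ _ (is_RInt_plus _ _ _ _ _ _ (is_RInt_cos_moment 0 (S n))
   (is_RInt_scal _ _ _ (INR n + 1) _ (is_RInt_minus _ _ _ _ _ _
     (is_RInt_scal _ _ _ (2 * INR n + 2) _ (is_RInt_cos_moment 2 (S n)))
     (is_RInt_scal _ _ _ (2 * INR n + 1) _ (is_RInt_cos_moment 2 n)))))).
  intros x _; replace (2 * S n)%nat with (S (S (2 * n))) by lia.
  unfold minus, plus, opp, scal, mult; simpl; unfold mult; simpl; ring.
Qed.

(** Equates two evaluations of one integral: [l], obtained by linearity from the moments, and the
    boundary values of [F]. Differentiability of [f] serves to give its continuity. *)
Lemma is_RInt_antiderivative (F f : R -> R) (a b l : R) :
  (forall x, is_derive F x (f x)) -> (forall x, ex_derive f x) ->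
  is_RInt f a b l -> l = F b - F a.
Proof.
  intros HF Hf Hl.
  rewrite <- (is_RInt_unique _ _ _ _ Hl).
  apply (is_RInt_unique (V := R_CompleteNormedModule)).
  apply (is_RInt_derive (V := R_CompleteNormedModule)); intros x _; trivial.
  exact (ex_derive_continuous f x (Hf x)).
Qed.

Lemma cos_moment_0_S (n : nat) :
  (2 * INR n + 2) * cos_moment 0 (S n) = (2 * INR n + 1) * cos_moment 0 n.
Proof.
  assert (E := is_RInt_antiderivative (fun t => sin t * cos t ^ S (2 * n)) _ _ _ _
    ltac:(intros x; generalize (is_derive_sin_cos_pow (2 * n) x);
          rewrite mult_INR; intros H; exact H)
    ltac:(intros x; auto_derive; trivial) (is_RInt_cos_moment_0 n)).
  cbv beta in E; rewrite cos_PI2, sin_0, pow_i in E by lia.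
  lra.
Qed.

Lemma cos_moment_0_2 (n : nat) :
  cos_moment 0 (S n)
  = (INR n + 1) * ((2 * INR n + 1) * cos_moment 2 n
                   - (2 * INR n + 2) * cos_moment 2 (S n)).
Proof.
  assert (E := is_RInt_antiderivative (fun t => t * cos t ^ S (S (2 * n))
      + (INR n + 1) * (t ^ 2 * (sin t * cos t ^ S (2 * n)))) _ _ _ _
    ltac:(intros x; generalize (is_derive_sqr_sin_cos_pow (2 * n) x);
          rewrite mult_INR; change (INR 2) with 2;
          replace (2 * INR n / 2 + 1) with (INR n + 1) by field; intros H; exact H)
    ltac:(intros x; auto_derive; trivial) (is_RInt_cos_moment_2 n)).
  cbv beta in E; rewrite cos_PI2, sin_0, !(pow_i (S _)) in E by lia.
  lra.
Qed.

Lemma cos_moment_0_0 : cos_moment 0 0 = PI / 2.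
Proof.
  unfold cos_moment; rewrite (RInt_ext _ (fun _ => 1)).
  - rewrite RInt_const; unfold scal; simpl; unfold mult; simpl; ring.
  - intros; simpl; ring.
Qed.

Lemma cos_moment_2_0 : cos_moment 2 0 = PI ^ 3 / 24.
Proof.
  apply (is_RInt_unique (V := R_CompleteNormedModule)).
  replace (PI ^ 3 / 24) with (minus ((PI / 2) ^ 3 / 3) (0 ^ 3 / 3)).
  - apply (is_RInt_derive (V := R_CompleteNormedModule) (fun x => x ^ 3 / 3)).
    + intros x _; auto_derive; trivial; simpl; field.
    + intros x _; apply continuity_pt_filterlim, derivable_continuous_pt.
      apply ex_derive_Reals_0; auto_derive; trivial.
  - unfold minus, plus, opp; simpl; field.
Qed.

Lemma cos_moment_0_pos (n : nat) : 0 < cos_moment 0 n.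
Proof.
  induction n as [|n IH].
  - rewrite cos_moment_0_0; generalize PI_RGT_0; lra.
  - generalize (cos_moment_0_S n) (pos_INR n); intros; nra.
Qed.

(** This is [x <= tan x] cleared of its denominator: [sin t - t * cos t] is [0] at [0] and has
    derivative [t * sin t >= 0]. *)
Lemma mul_cos_le_sin (x : R) : 0 <= x <= PI / 2 -> x * cos x <= sin x.
Proof.
  intros [H0 H1].
  destruct (MVT_gen (fun t => sin t - t * cos t) 0 x (fun t => t * sin t))
    as [c [Hc E]].
  - intros; auto_derive; trivial; ring.
  - intros; apply derivable_continuous_pt, ex_derive_Reals_0; auto_derive; trivial.
  - rewrite Rmin_left, Rmax_right in Hc by lra.
    rewrite sin_0 in E.
    assert (0 <= sin c) by (apply sin_ge_0; lra).
    assert (0 <= c * sin c * (x - 0)) by (repeat apply Rmult_le_pos; lra).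
    lra.
Qed.

(** Squaring [x * cos x <= sin x] gives [x ^ 2 * cos x ^ 2 <= 1 - cos x ^ 2]; multiply by
    [cos x ^ (2 * n)] and integrate. *)
Lemma cos_moment_2_bound (n : nat) :
  0 <= cos_moment 2 (S n) <= cos_moment 0 n - cos_moment 0 (S n).
Proof.
  assert (HP := PI_RGT_0).
  split.
  - apply (is_RInt_le (fun _ => 0) (fun x => x ^ 2 * cos x ^ (2 * S n)) 0 (PI / 2)).
    + lra.
    + generalize (is_RInt_const (V := R_NormedModule) 0 (PI / 2) 0).
      unfold scal; simpl; unfold mult; simpl; rewrite Rmult_0_r; trivial.
    + apply is_RInt_cos_moment.
    + intros x _; rewrite pow_mult; apply Rmult_le_pos; [|apply pow_le]; apply pow2_ge_0.
  - apply (is_RInt_le (fun x => x ^ 2 * cos x ^ (2 * S n))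
      (fun x => minus (x ^ 0 * cos x ^ (2 * n)) (x ^ 0 * cos x ^ (2 * S n))) 0 (PI / 2)).
    + lra.
    + apply is_RInt_cos_moment.
    + apply (is_RInt_minus (V := R_NormedModule)); apply is_RInt_cos_moment.
    + intros x Hx; unfold minus, plus, opp; simpl (_ ^ 0); simpl Hierarchy.opp.
      replace (2 * S n)%nat with (2 + 2 * n)%nat by lia.
      rewrite pow_add, pow_mult.
      assert (Hc : 0 <= (cos x ^ 2) ^ n) by (apply pow_le, pow2_ge_0).
      assert (Hm : x * cos x <= sin x) by (apply mul_cos_le_sin; lra).
      assert (H0 : 0 <= x * cos x) by (apply Rmult_le_pos; [|apply cos_ge_0]; lra).
      assert (E : sin x ^ 2 = 1 - cos x ^ 2)
        by (generalize (sin2_cos2 x); unfold Rsqr; simpl; lra).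
      assert (Hq : (x * cos x) ^ 2 <= sin x ^ 2) by (apply pow_incr; lra).
      rewrite Rpow_mult_distr, E in Hq.
      assert (H := Rmult_le_compat_r _ _ _ Hc Hq).
      simpl in *; lra.
Qed.

(** * The value of [zeta 2] *)

Lemma sum_n_inv_sqr (n : nat) :
  PI ^ 2 / 6 - 2 * (cos_moment 2 (S n) / cos_moment 0 (S n))
  = sum_n (fun k => / (INR k + 1) ^ 2) n.
Proof.
  assert (Hstep : forall k, / (INR k + 1) ^ 2
    = 2 * (cos_moment 2 k / cos_moment 0 k)
      - 2 * (cos_moment 2 (S k) / cos_moment 0 (S k))).
  { intros k.
    assert (H0 := cos_moment_0_pos k); assert (H1 := cos_moment_0_pos (S k)).
    assert (HS := cos_moment_0_S k); assert (H2 := cos_moment_0_2 k).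
    assert (Hk := pos_INR k).
    (* Both moments at [k] are expressed through those at [S k]; the ratios at [S k] then cancel and
       leave [1 / (k + 1) ^ 2]. *)
    assert (E0 : cos_moment 0 k = (2 * INR k + 2) / (2 * INR k + 1) * cos_moment 0 (S k)).
    { apply (Rmult_eq_reg_l (2 * INR k + 1)); [|lra].
      rewrite <- HS; field; lra. }
    assert (E2 : cos_moment 2 k = cos_moment 0 (S k) / ((INR k + 1) * (2 * INR k + 1))
       + (2 * INR k + 2) / (2 * INR k + 1) * cos_moment 2 (S k)).
    { rewrite H2; field; lra. }
    rewrite E0, E2; field; repeat split; lra. }
  induction n as [|n IH].
  (* The constant [PI ^ 2 / 6] is [2 * J_0 / I_0], the initial value of the telescoping sum. *)
  - rewrite sum_O, Hstep, cos_moment_0_0, cos_moment_2_0.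
    field; generalize (cos_moment_0_pos 1) PI_RGT_0; intros; split; lra.
  - rewrite sum_Sn, <- IH, Hstep; unfold plus; simpl; ring.
Qed.

Lemma is_lim_seq_c_div_INR (c : R) : is_lim_seq (fun n => c / (INR n + 1)) 0.
Proof.
  replace (Finite 0) with (Rbar_mult c 0) by (simpl; f_equal; ring).
  apply is_lim_seq_scal_l.
  apply (is_lim_seq_ext (fun n => / INR (S n))).
  - intros n; rewrite S_INR; reflexivity.
  - apply (is_lim_seq_incr_1 (fun n => / INR n)).
    apply (is_lim_seq_inv _ p_infty is_lim_seq_INR); discriminate.
Qed.

Lemma basel : is_series (fun k => / (INR k + 1) ^ 2) (PI ^ 2 / 6).
Proof.
  change (is_lim_seq (sum_n (fun k => / (INR k + 1) ^ 2)) (PI ^ 2 / 6)).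
  apply (is_lim_seq_ext
    (fun n => PI ^ 2 / 6 - 2 * (cos_moment 2 (S n) / cos_moment 0 (S n)))).
  - intros n; apply sum_n_inv_sqr.
  - replace (Finite (PI ^ 2 / 6)) with (Finite (PI ^ 2 / 6 - 2 * 0)) by (f_equal; ring).
    apply is_lim_seq_minus'; [apply is_lim_seq_const|].
    apply (is_lim_seq_scal_l _ 2 0).
    (* By the Wallis recursion [I_n - I_(n+1) = I_(n+1) / (2n + 1)], so [J_(n+1) / I_(n+1)] is at
       most [1 / (2n + 1) <= 1 / (n + 1)]. *)
    apply (is_lim_seq_le_le (fun _ => 0) _ (fun n => 1 / (INR n + 1)));
      [|apply is_lim_seq_const|apply is_lim_seq_c_div_INR].
    intros n.
    assert (H1 := cos_moment_0_pos (S n)); assert (Hk := pos_INR n).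
    assert (HS := cos_moment_0_S n); assert (HB := cos_moment_2_bound n).
    split.
    + apply Rmult_le_pos; [|apply Rlt_le, Rinv_0_lt_compat]; lra.
    + apply (Rmult_le_reg_r (cos_moment 0 (S n))); trivial.
      replace (cos_moment 2 (S n) / cos_moment 0 (S n) * cos_moment 0 (S n))
        with (cos_moment 2 (S n)) by (field; lra).
      apply (Rmult_le_reg_l (INR n + 1)); [lra|].
      replace ((INR n + 1) * (1 / (INR n + 1) * cos_moment 0 (S n)))
        with (cos_moment 0 (S n)) by (field; lra).
      nra.
Qed.

Lemma zeta_2 : zeta 2 = PI ^ 2 / 6.
Proof.
  apply is_series_unique.
  apply (is_series_congr _ _ _ _ basel); [|trivial].
  intros k; f_equal.
  replace 2 with (INR 2) by reflexivity.
  rewrite Rpower_pow, S_INR; trivial.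
  apply lt_0_INR; lia.
Qed.

(** * Limit of the odd harmonic sums *)

(** The reciprocal squares of [1, ..., 2m + 2] minus those of the even numbers, which are a quarter
    of the reciprocal squares of [1, ..., m + 1]. The successor is there because [sum_n] always has
    at least one term. *)
Lemma odd_harmonic_2_S (m : nat) :
  odd_harmonic 2 (S m)
  = sum_n (fun k => / (INR k + 1) ^ 2) (2 * m + 1)
    - / 4 * sum_n (fun k => / (INR k + 1) ^ 2) m.
Proof.
  induction m as [|m IH].
  - unfold odd_harmonic; rewrite sum_n_n; change (2 * 0 + 1)%nat with 1%nat.
    rewrite sum_Sn, !sum_O; unfold plus; simpl; field.
  - unfold odd_harmonic in *; rewrite sum_n_Sm, IH by lia.
    replace (2 * S m + 1)%nat with (S (S (2 * m + 1))) by lia.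
    rewrite !sum_Sn; change (@plus R_AbelianMonoid) with Rplus.
    rewrite !S_INR, plus_INR, mult_INR; change (INR 2) with 2; change (INR 1) with 1.
    assert (H := pos_INR m).
    field; repeat split; nra.
Qed.

Lemma is_lim_seq_odd_harmonic (l : R) :
  is_series (fun k => / (INR k + 1) ^ 2) l ->
  is_lim_seq (fun m => 4 * odd_harmonic 2 m - 3 * l) 0.
Proof.
  intros Hl.
  apply is_lim_seq_incr_1.
  apply (is_lim_seq_ext (fun m =>
    4 * (sum_n (fun k => / (INR k + 1) ^ 2) (2 * m + 1)
         - / 4 * sum_n (fun k => / (INR k + 1) ^ 2) m) - 3 * l)).
  { intros m; rewrite odd_harmonic_2_S; reflexivity. }
  replace (Finite 0) with (Finite (4 * (l - / 4 * l) - 3 * l)) by (f_equal; field).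
  apply is_lim_seq_minus'; [|apply is_lim_seq_const].
  apply (is_lim_seq_scal_l _ 4 (l - / 4 * l)).
  apply is_lim_seq_minus'.
  - apply (is_lim_seq_subseq (sum_n (fun k => / (INR k + 1) ^ 2)) l (fun m => (2 * m + 1)%nat)); trivial.
    apply eventually_subseq; intros; lia.
  - apply (is_lim_seq_scal_l _ (/ 4) l); exact Hl.
Qed.

(** * The normalised series and its recursion in [a] *)

(* [beta_ratio a k] is [k! / (a (a + 1) ... (a + k))]. *)
Fixpoint beta_ratio (a : R) (k : nat) : R :=
  match k with
  | O => / a
  | S k => beta_ratio a k * (INR k + 1) / (a + INR k + 1)
  end.

Lemma beta_ratio_succ (a : R) (k : nat) :
  0 < a -> beta_ratio (a + 1) k = beta_ratio a k * a / (a + INR k + 1).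
Proof.
  intros Ha; induction k as [|k IH].
  - simpl; field; lra.
  - change (beta_ratio (a + 1) k * (INR k + 1) / (a + 1 + INR k + 1)
      = beta_ratio a k * (INR k + 1) / (a + INR k + 1) * a / (a + INR (S k) + 1)).
    rewrite IH, S_INR; assert (H := pos_INR k); field; lra.
Qed.

(** Starting from [1 / a <= 2], each further factor [1 - a / (a + k + 1)] lies in [[0, 1]]. The
    bound is uniform in [a], which the limit argument relies on. *)
Lemma beta_ratio_bound (a : R) (k : nat) :
  / 2 <= a -> 0 <= beta_ratio a k <= 2.
Proof.
  intros Ha; induction k as [|k IH]; cbn [beta_ratio].
  - split; [apply Rlt_le, Rinv_0_lt_compat; lra|].
    replace 2 with (/ / 2) by field; apply Rinv_le_contravar; lra.
  - assert (H := pos_INR k).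
    replace (beta_ratio a k * (INR k + 1) / (a + INR k + 1))
      with (beta_ratio a k * (1 - a / (a + INR k + 1))) by (field; lra).
    assert (0 <= a / (a + INR k + 1) <= 1).
    { split; [apply Rdiv_le_0_compat; lra|].
      apply (Rdiv_le_1 a (a + INR k + 1)); lra. }
    nra.
Qed.

(** The index is [k = n - 1], so the three factors are [n + 1], [n + 2] and [n + 3]. *)
Definition beta_term (a : R) (k : nat) : R :=
  beta_ratio a k / ((INR k + 2) * (INR k + 3) * (INR k + 4)).

(** Discrete antiderivative, in [k], of the combination of [beta_term (a + 1)] and [beta_term a]
    that gives the recursion in [a]. *)
Definition gosper_certificate (a : R) (k : nat) : R :=
  beta_ratio a k / ((INR k + 2) * (INR k + 3)).

Lemma beta_term_telescope (a : R) (k : nat) :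
  0 < a ->
  (a - 1) * beta_term (a + 1) k - (a + 2) * beta_term a k
  = gosper_certificate a (S k) - gosper_certificate a k.
Proof.
  intros Ha; unfold beta_term, gosper_certificate.
  rewrite beta_ratio_succ by trivial; cbn [beta_ratio]; rewrite S_INR.
  assert (H := pos_INR k); field; repeat split; lra.
Qed.

Lemma is_series_telescope (u : nat -> R) (l : R) :
  is_lim_seq u l -> is_series (fun k => u (S k) - u k) (l - u O).
Proof.
  intros Hu.
  change (is_lim_seq (sum_n (fun k => u (S k) - u k)) (l - u O)).
  apply (is_lim_seq_ext (fun n => u (S n) - u O)).
  - intros n; induction n as [|n IH].
    + rewrite sum_O; reflexivity.
    + rewrite sum_Sn, <- IH; unfold plus; simpl; ring.
  - apply is_lim_seq_minus'; [|apply is_lim_seq_const].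
    exact (proj1 (is_lim_seq_incr_1 u l) Hu).
Qed.

Lemma is_lim_seq_gosper_certificate (a : R) :
  / 2 <= a -> is_lim_seq (gosper_certificate a) 0.
Proof.
  intros Ha.
  apply (is_lim_seq_le_le (fun _ => 0) _ (fun n => 2 / (INR n + 1)));
    [|apply is_lim_seq_const|apply is_lim_seq_c_div_INR].
  intros k; unfold gosper_certificate.
  assert (H := pos_INR k); assert (HB := beta_ratio_bound a k Ha).
  split.
  - apply Rdiv_le_0_compat; nra.
  - apply Rmult_le_compat; try lra.
    + apply Rlt_le, Rinv_0_lt_compat; nra.
    + apply Rinv_le_contravar; nra.
Qed.

Lemma is_series_beta_bound :
  is_series (fun k => 2 / (INR k + 1) - 2 / (INR (S k) + 1)) 2.
Proof.
  (* With [u k = - 2 / (k + 1)] the sum is [0 - u 0 = 2]. *)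
  assert (H := is_series_telescope _ 0 (is_lim_seq_c_div_INR (- 2))).
  apply (is_series_congr _ _ _ _ H); [|simpl; field].
  intros k; rewrite S_INR; assert (Hk := pos_INR k); field; lra.
Qed.

Lemma beta_term_bound (a : R) (k : nat) :
  / 2 <= a -> 0 <= beta_term a k <= 2 / (INR k + 1) - 2 / (INR (S k) + 1).
Proof.
  intros Ha; unfold beta_term.
  assert (H := pos_INR k); assert (HB := beta_ratio_bound a k Ha).
  assert (Hp : 0 < (INR k + 2) * (INR k + 3)) by nra.
  split.
  - apply Rdiv_le_0_compat; nra.
  - rewrite S_INR.
    replace (2 / (INR k + 1) - 2 / (INR k + 1 + 1))
      with (2 * / ((INR k + 1) * (INR k + 2))) by (field; lra).
    apply Rmult_le_compat; try lra.
    + apply Rlt_le, Rinv_0_lt_compat; nra.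
    + apply Rinv_le_contravar; nra.
Qed.

Lemma ex_series_beta_term (a : R) : / 2 <= a -> ex_series (beta_term a).
Proof.
  intros Ha.
  apply (ex_series_le (V := R_CompleteNormedModule) _
    (fun k => 2 / (INR k + 1) - 2 / (INR (S k) + 1))).
  - intros k; assert (H := beta_term_bound a k Ha).
    change (Rabs (beta_term a k) <= 2 / (INR k + 1) - 2 / (INR (S k) + 1)).
    rewrite Rabs_pos_eq; lra.
  - exists 2; apply is_series_beta_bound.
Qed.

Lemma Series_beta_term_bound (a : R) : / 2 <= a -> 0 <= Series (beta_term a) <= 2.
Proof.
  intros Ha; split.
  (* The bound [0] is written as the sum of [0 * beta_term a k], so that termwise comparison
     applies. *)
  - rewrite <- (Rmult_0_l (Series (beta_term a))) at 1; rewrite <- Series_scal_l.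
    apply Series_le; [|apply ex_series_beta_term; trivial].
    intros k; assert (H := beta_term_bound a k Ha); lra.
  - rewrite <- (is_series_unique _ _ is_series_beta_bound).
    apply Series_le; [intros k; apply beta_term_bound; trivial|].
    exists 2; apply is_series_beta_bound.
Qed.

(** The certificate tends to [0] and starts at [1 / (6 * a)], so its differences sum to
    [- / (6 * a)]. *)
Lemma Series_beta_term_succ (a : R) :
  / 2 <= a ->
  (a - 1) * Series (beta_term (a + 1)) - (a + 2) * Series (beta_term a) = - / (6 * a).
Proof.
  intros Ha.
  rewrite <- !Series_scal_l, <- Series_minus
    by (apply (ex_series_scal_l (V := R_NormedModule) _ (beta_term _)), ex_series_beta_term; lra).
  rewrite (Series_ext _ (fun k => gosper_certificate a (S k) - gosper_certificate a k))
    by (intros k; apply beta_term_telescope; lra).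
  rewrite (is_series_unique _ _ (is_series_telescope _ 0 (is_lim_seq_gosper_certificate a Ha))).
  unfold gosper_certificate; simpl; field; lra.
Qed.

(** * Closed form of the normalised series *)

Lemma Series_beta_term (l : R) (m : nat) :
  is_series (fun k => / (INR k + 1) ^ 2) l ->
  Series (beta_term (INR m + 1 / 2))
  = (INR m - 1 / 2) * (INR m + 1 / 2) * (INR m + 3 / 2) / 12
      * (4 * odd_harmonic 2 m - 3 * l)
    + 1 / 4 * (INR m ^ 2 / 3 + INR m / 2 - 1 / 9).
Proof.
  intros Hl.
  (* [d] solves the homogeneous recursion [(n - 1/2) d (n+1) = (n + 5/2) d n]; dividing by it
     reduces the recursion to the increments of [odd_harmonic]. *)
  set (d n := (INR n - 1 / 2) * (INR n + 1 / 2) * (INR n + 3 / 2)).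
  set (q n := 1 / 4 * (INR n ^ 2 / 3 + INR n / 2 - 1 / 9)).
  set (v n := 12 * (Series (beta_term (INR n + 1 / 2)) - q n) / d n
              - (4 * odd_harmonic 2 n - 3 * l)).
  assert (Hd1 : forall n, INR n - 1 / 2 <> 0).
  { intros [|n]; [simpl; lra|rewrite S_INR; generalize (pos_INR n); lra]. }
  assert (Hd : forall n, d n <> 0).
  { intros n; unfold d; generalize (pos_INR n); intros Hn.
    repeat apply Rmult_integral_contrapositive_currified; trivial; lra. }
  assert (Hv : forall n, v (S n) = v n).
  { intros n; unfold v.
    assert (Hn := pos_INR n); assert (Hn1 := Hd1 n).
    assert (HU := Series_beta_term_succ (INR n + 1 / 2) ltac:(lra)).
    replace (INR n + 1 / 2 + 1) with (INR (S n) + 1 / 2) in HU by (rewrite S_INR; ring).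
    assert (EU : Series (beta_term (INR (S n) + 1 / 2))
      = ((INR n + 5 / 2) * Series (beta_term (INR n + 1 / 2)) - / (6 * (INR n + 1 / 2)))
        / (INR n - 1 / 2)).
    { apply (Rmult_eq_reg_l (INR n - 1 / 2)); trivial.
      transitivity ((INR n + 5 / 2) * Series (beta_term (INR n + 1 / 2)) - / (6 * (INR n + 1 / 2)));
        [lra|field; lra]. }
    assert (EO : odd_harmonic 2 (S n) = odd_harmonic 2 n + / (2 * INR n + 1) ^ 2).
    { unfold odd_harmonic; rewrite sum_n_Sm by lia; change (@plus R_AbelianMonoid) with Rplus.
      rewrite S_INR; f_equal; f_equal; f_equal; ring. }
    rewrite EU, EO; unfold d, q; rewrite S_INR.
    field; repeat split; lra. }
  assert (Hc : forall n, v n = v O).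
  { induction n as [|n IH]; [trivial|rewrite Hv; trivial]. }
  assert (Hlim : is_lim_seq v 0).
  { replace (Finite 0) with (Finite (0 - 0)) by (f_equal; ring).
    apply is_lim_seq_minus'; [|apply is_lim_seq_odd_harmonic; trivial].
    (* After a shift by 2 every factor of [d] exceeds [n + 1], so the denominator is at least
       [(n + 1) ^ 3], while [Series - q] is at most [2 * (n + 1) ^ 2] in absolute value. *)
    apply (is_lim_seq_incr_n _ 2).
    apply is_lim_seq_abs_0.
    apply (is_lim_seq_le_le (fun _ => 0) _ (fun n => 24 / (INR n + 1)));
      [|apply is_lim_seq_const|apply is_lim_seq_c_div_INR].
    intros n; split; [apply Rabs_pos|].
    assert (Hn := pos_INR n).
    assert (HU := Series_beta_term_bound (INR (n + 2) + 1 / 2)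
                    ltac:(generalize (pos_INR (n + 2)); lra)).
    assert (E : INR (n + 2) = INR n + 2) by (rewrite plus_INR; reflexivity).
    revert HU; unfold q, d; rewrite E.
    generalize (Series (beta_term (INR n + 2 + 1 / 2))).
    generalize dependent (INR n); clear; intros x Hx _ u Hu.
    assert (Hq : Rabs (u - 1 / 4 * ((x + 2) ^ 2 / 3 + (x + 2) / 2 - 1 / 9)) <= 2 * (x + 1) ^ 2).
    { apply Rabs_le; split; nra. }
    assert (Hp : (x + 1) ^ 3 <= (x + 2 - 1 / 2) * (x + 2 + 1 / 2) * (x + 2 + 3 / 2)) by nra.
    assert (H3 : 0 < (x + 1) ^ 3) by (apply pow_lt; lra).
    unfold Rdiv at 1; rewrite !Rabs_mult, Rabs_inv, (Rabs_pos_eq 12) by lra.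
    rewrite (Rabs_pos_eq ((x + 2 - 1 / 2) * _ * _)) by lra.
    replace (24 / (x + 1)) with (12 * (2 * (x + 1) ^ 2) * / (x + 1) ^ 3) by (field; lra).
    apply Rmult_le_compat; try lra.
    - apply Rmult_le_pos; [lra|apply Rabs_pos].
    - apply Rlt_le, Rinv_0_lt_compat; lra.
    - apply Rinv_le_contravar; lra. }
  assert (H0 : v O = 0).
  (* A constant sequence with limit [0] is [0]. *)
  { apply is_lim_seq_unique in Hlim.
    rewrite (Lim_seq_ext v (fun _ => v O) Hc), Lim_seq_const in Hlim.
    congruence. }
  assert (Hm := Hc m); rewrite H0 in Hm; unfold v in Hm.
  fold (d m) (q m).
  assert (E : 4 * odd_harmonic 2 m - 3 * l
    = 12 * (Series (beta_term (INR m + 1 / 2)) - q m) / d m) by lra.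
  rewrite E; field; apply Hd.
Qed.

(** * Return to binomial coefficients and the special cases *)

Lemma binom_pos (n k : nat) : 0 < binom n k.
Proof.
  apply Rdiv_lt_0_compat; [|apply Rmult_lt_0_compat]; apply INR_fact_lt_0.
Qed.

Lemma central_binom_succ (n : nat) :
  binom (2 * S n) (S n) = binom (2 * n) n * (2 * (2 * INR n + 1)) / (INR n + 1).
Proof.
  unfold binom, Binomial.C.
  replace (2 * S n - S n)%nat with (S n) by lia.
  replace (2 * n - n)%nat with n by lia.
  replace (2 * S n)%nat with (S (S (2 * n))) by lia.
  rewrite !fact_simpl, !mult_INR, !S_INR, !mult_INR; change (INR 2) with 2.
  assert (H := pos_INR n); field.
  split; [apply INR_fact_neq_0|lra].
Qed.

Lemma binom_succ_l (n m : nat) :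
  binom (S n + m) m = binom (n + m) m * (INR n + INR m + 1) / (INR n + 1).
Proof.
  unfold binom, Binomial.C.
  replace (S n + m - m)%nat with (S n) by lia.
  replace (n + m - m)%nat with n by lia.
  change (S n + m)%nat with (S (n + m)).
  rewrite !fact_simpl, !mult_INR, !S_INR, plus_INR.
  assert (H := pos_INR n); field.
  repeat split; try lra; apply INR_fact_neq_0.
Qed.

(** Passing from [k] to [S k] multiplies both sides by [(k + 1) / (m + 1/2 + k + 1)]; on the right,
    the factors [k + m + 2] from the two binomial ratios cancel. *)
Lemma beta_ratio_binom (m k : nat) :
  beta_ratio (INR m + 1 / 2) k
  = binom (2 * m) m * 2 ^ (2 * S k)
    / (INR (S k) * binom (2 * (S k + m)) (S k + m) * binom (S k + m) m).
Proof.
  assert (Hm := pos_INR m).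
  induction k as [|k IH].
  - change (1 + m)%nat with (S m); rewrite central_binom_succ.
    change (S m) with (1 + m)%nat; rewrite binom_succ_l.
    change (0 + m)%nat with m.
    replace (binom m m) with 1 by (symmetry; apply C_n_n).
    assert (H := binom_pos (2 * m) m).
    change (INR 0) with 0; change (INR 1) with 1; change (2 * 1)%nat with 2%nat.
    cbn [beta_ratio]; field; repeat split; lra.
  - assert (Hk := pos_INR k).
    cbn [beta_ratio]; rewrite IH.
    rewrite (binom_succ_l (S k) m).
    change (S (S k) + m)%nat with (S (S k + m)); rewrite central_binom_succ.
    replace (2 * S (S k))%nat with (2 + 2 * S k)%nat by lia.
    rewrite pow_add, !plus_INR, !S_INR.
    assert (H1 := binom_pos (2 * (S k + m)) (S k + m)).
    assert (H2 := binom_pos (S k + m) m).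
    field; repeat split; lra.
Qed.

(** Dividing the closed form of the normalised series by [binom (2 * m) m] undoes the
    normalisation. *)
Lemma is_series_central_binom_reciprocal (m : nat) :
     is_series
       (fun k => let n := S k in
          2 ^ (2 * n) /
          (INR n * (INR n + 1) * (INR n + 2) * (INR n + 3)
           * binom (2 * (n + m)) (n + m) * binom (n + m) m))
       (1 / (12 * binom (2 * m) m)
          * (INR m - 1 / 2) * (INR m + 1 / 2) * (INR m + 3 / 2)
          * (4 * odd_harmonic 2 m - 3 * zeta 2)
        + 1 / (4 * binom (2 * m) m)
          * (INR m ^ 2 / 3 + INR m / 2 - 1 / 9)).
Proof.
  assert (H0 := binom_pos (2 * m) m); assert (Hm := pos_INR m).
  assert (HS : is_series (fun k => / binom (2 * m) m * beta_term (INR m + 1 / 2) k)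
                         (/ binom (2 * m) m * Series (beta_term (INR m + 1 / 2)))).
  { apply (is_series_scal_l (V := R_NormedModule)).
    apply Series_correct, ex_series_beta_term; lra. }
  rewrite (Series_beta_term (zeta 2) m) in HS by (rewrite zeta_2; apply basel).
  apply (is_series_congr _ _ _ _ HS); [|field; lra].
  intros k; unfold beta_term; cbv zeta; rewrite beta_ratio_binom.
  assert (H1 := binom_pos (2 * (S k + m)) (S k + m)).
  assert (H2 := binom_pos (S k + m) m).
  assert (Hk := pos_INR k).
  rewrite !S_INR; field; repeat split; lra.
Qed.

Theorem theorem14 :
  (forall m : nat,
     is_series
       (fun k => let n := S k in
          2 ^ (2 * n) /
          (INR n * (INR n + 1) * (INR n + 2) * (INR n + 3)
           * binom (2 * (n + m)) (n + m) * binom (n + m) m))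
       (1 / (12 * binom (2 * m) m)
          * (INR m - 1 / 2) * (INR m + 1 / 2) * (INR m + 3 / 2)
          * (4 * odd_harmonic 2 m - 3 * zeta 2)
        + 1 / (4 * binom (2 * m) m)
          * (INR m ^ 2 / 3 + INR m / 2 - 1 / 9)))
  /\ is_series
       (fun k => let n := S k in
          2 ^ (2 * n) /
          (INR n * (INR n + 1) * (INR n + 2) * (INR n + 3)
           * binom (2 * n) n))
       (PI ^ 2 / 64 - 1 / 36)
  /\ is_series
       (fun k => let n := S k in
          2 ^ (2 * n) /
          (INR n * (INR n + 1) ^ 2 * (INR n + 2) * (INR n + 3)
           * binom (2 * (n + 1)) (n + 1)))
       (29 / 72 - 5 * PI ^ 2 / 128)
  /\ is_series
       (fun k => let n := S k in
          2 ^ (2 * n + 1) /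
          (INR n * (INR n + 1) ^ 2 * (INR n + 2) ^ 2 * (INR n + 3)
           * binom (2 * (n + 2)) (n + 2)))
       (65 / 72 - 35 * PI ^ 2 / 384).
Proof.
  split; [exact is_series_central_binom_reciprocal|].
  assert (Hb : forall n, binom n 0 = 1) by exact C_n_0.
  assert (Hb1 : forall n, binom (n + 1) 1 = INR n + 1).
  { induction n as [|n IH]; [rewrite (C_n_n 1 : binom (0 + 1) 1 = 1); simpl; ring|].
    rewrite binom_succ_l, IH, !S_INR; change (INR 0) with 0; assert (H := pos_INR n); field; lra. }
  assert (Hb2 : forall n, binom (n + 2) 2 = (INR n + 1) * (INR n + 2) / 2).
  { induction n as [|n IH]; [rewrite (C_n_n 2 : binom (0 + 2) 2 = 1); simpl; field|].
    rewrite binom_succ_l, IH, !S_INR; change (INR 0) with 0; assert (H := pos_INR n); field; lra. }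
  repeat split.
  - apply (is_series_congr _ _ _ _ (is_series_central_binom_reciprocal 0)).
    + intros k; cbv zeta; rewrite Hb, Nat.add_0_r, Rmult_1_r; reflexivity.
    + rewrite zeta_2, Hb; unfold odd_harmonic; rewrite sum_n_m_zero by lia.
      unfold zero; simpl; field.
  - apply (is_series_congr _ _ _ _ (is_series_central_binom_reciprocal 1)).
    (* [binom (n + 1) 1] supplies the second factor [n + 1]. *)
    + intros k; cbv zeta; rewrite Hb1.
      assert (H := binom_pos (2 * (S k + 1)) (S k + 1)); assert (Hk := pos_INR k).
      rewrite !S_INR; field; repeat split; lra.
    + rewrite zeta_2, central_binom_succ, Hb; unfold odd_harmonic; rewrite sum_n_n.
      simpl; field.
  - apply (is_series_congr _ _ _ _ (is_series_central_binom_reciprocal 2)).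
    (* The denominator 2 in [binom (n + 2) 2] turns [2 ^ (2 * n)] into [2 ^ (2 * n + 1)]. *)
    + intros k; cbv zeta; rewrite Hb2.
      assert (H := binom_pos (2 * (S k + 2)) (S k + 2)); assert (Hk := pos_INR k).
      rewrite pow_add, !S_INR; field; repeat split; lra.
    + rewrite zeta_2, !central_binom_succ, Hb; unfold odd_harmonic.
      rewrite sum_n_Sm, sum_n_n by lia; unfold plus; simpl; field.
Qed.
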